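(* Let $n\ge2$ and let $Q_z$ be the linear operator on $\mathbb{C}[x_1,\ldots,x_n]^{S_n}$ defined by $Q_z\bar s_\lambda=q_\lambda(z)\bar s_\lambda$, $q_\lambda(z)=\bar s_\lambda(z,1,\ldots,1)$, for all partitions $\lambda$ of length $n$. Let $\mathcal P:\mathbb{C}[x_1,\ldots,x_n]^{S_n}\to\mathbb{C}[x_1,\ldots,x_{n-1}]^{S_{n-1}}$ be given by $(\mathcal Pf)(x_1,\ldots,x_{n-1})=f(x_1,\ldots,x_{n-1},0)$. Then the operator $Q_0$ (that is, $Q_z$ taken at $z=0$) admits a unique factorization $Q_0=Q_0'\mathcal P$ with a linear operator $Q_0':\mathbb{C}[x_1,\ldots,x_{n-1}]^{S_{n-1}}\to\mathbb{C}[x_1,\ldots,x_n]^{S_n}$, and for every partition $(\lambda_1,\ldots,\lambda_{n-1})$ of length $n-1$, $$Q_0':\ \bar s_{(\lambda_1,\ldots,\lambda_{n-1})}(x_1,\ldots,x_{n-1})\mapsto\bar s_{(\lambda_1,\ldots,\lambda_{n-1},0)}(x_1,\ldots,x_n).$$ For real $0<y_1<y_2<\cdots<y_n$ and $f\in\mathbb{C}[x_1,\ldots,x_{n-1}]^{S_{n-1}}$ the value $[Q_0'f](y)$ is given by the integral $$[Q_0'f](y)=(-1)^{n-1}\frac{(n-1)!}{\Delta_n(y)}\int_{\Omega_x'}dx'\,\Delta_{n-1}(x')f(x'),$$ where $x'=(x_1,\ldots,x_{n-1})$ and $$\Omega_x':\quad 0<y_1<x_1<y_2<\cdots<x_{n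-1}<y_n.$$
   Context: Partitions of length $N$ are $\lambda=(\lambda_1,\ldots,\lambda_N)\in\mathbb{N}^N$ with $\lambda_1\ge\cdots\ge\lambda_N\ge0$. $\Delta_N(x)=\prod_{1\le i<j\le N}(x_i-x_j)$. For a partition $\lambda$ of length $N$ the Schur function in $N$ variables is $s_\lambda(x_1,\ldots,x_N)=\det\{x_i^{\lambda_j+N-j}\}_{i,j=1}^N/\Delta_N(x)$, and $\bar s_\lambda(x)=s_\lambda(x)/s_\lambda(1,\ldots,1)$; the $\bar s_\lambda$ form a basis of the space $\mathbb{C}[x_1,\ldots,x_N]^{S_N}$ of symmetric polynomials. $Q_z$ takes values in $\mathbb{C}[x_1,\ldots,x_n]^{S_n}\otimes\mathbb{C}[z]$. *)

(* Defs.v *)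
From HB Require Import structures.
From mathcomp Require Import all_boot all_order all_fingroup all_algebra.
From mathcomp Require Import complex.
(* mpoly has to come before the analysis files: the converse order makes the
   notations of the two libraries clash. *)
From mathcomp Require Import mpoly.
From mathcomp Require Import all_classical all_reals all_analysis.

Set Implicit Arguments.
Unset Strict Implicit.
Unset Printing Implicit Defensive.

Import Order.TTheory GRing.Theory Num.Theory.

Local Open Scope classical_set_scope.
Local Open Scope ring_scope.

Section Sympoly.
Variables (n : nat) (K : fieldType).

Record sympoly := Sympoly {
  sympoly_val :> {mpoly K[n]};
  sympoly_sym : sympoly_val \is symmetric }.

HB.instance Definition _ := [isSub for sympoly_val].
HB.instance Definition _ := [Choice of sympoly by <:].
HB.instance Definition _ := [SubChoice_isSubLmodule of sympoly by <:].

End Sympoly.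

Definition vandermonde (A : comNzRingType) (N : nat) (x : 'I_N -> A) : A :=
  \prod_(i < N) \prod_(j < N | (i < j)%N) (x i - x j).

Definition is_partition (N : nat) (lam : N.-tuple nat) : bool :=
  sorted geq lam.

(* The exponent lambda_j + N - j of the 1-based convention is
   lam_j + (N - j.+1) for 0-based j. *)
Definition alternant (K : fieldType) (N : nat) (lam : N.-tuple nat) :
    {mpoly K[N]} :=
  \det (\matrix_(i < N, j < N) 'X_i ^+ (tnth lam j + (N - j.+1))).

Section VandermondeDivides.

Lemma det_poly_eval (A : comNzRingType) (N : nat) (x : 'I_N -> A)
    (f : 'I_N -> {poly A}) :
  exists c, \det (\matrix_(i < N, j < N) (f j).[x i])
              = c * \prod_(i < N) \prod_(j < N | (i < j)%N) (x j - x i).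
Proof.
pose w : {poly A} := \prod_(i < N) ('X - (x i)%:P).
have wm : w \is monic by apply: monic_prod_XsubC.
have sw : size w = N.+1 by rewrite /w size_prod_XsubC /index_enum -enumT size_enum_ord.
pose r j := Pdiv.Ring.rmodp (f j) w.
have sr j : (size (r j) <= N)%N.
  by rewrite -ltnS -sw Pdiv.Ring.ltn_rmodpN0 // monic_neq0.
have fr i j : (f j).[x i] = (r j).[x i].
  rewrite [f j](Pdiv.RingMonic.rdivp_eq wm) hornerD hornerM.
  rewrite (_ : w.[x i] = 0) ?mulr0 ?add0r //.
  by rewrite /w horner_prod (bigD1 i) //= hornerXsubC subrr mul0r.
exists (\det (\matrix_(k < N, j < N) (r j)`_k)).
rewrite (_ : \prod_(i < N) _ = \det (Vandermonde N (\row_i x i))); last first.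
  rewrite det_Vandermonde; apply: eq_bigr => i _; apply: eq_bigr => j _.
  by rewrite !mxE.
rewrite mulrC -[X in X * _]det_tr -det_mulmx; congr (\det _).
apply/matrixP => i j; rewrite !mxE fr (horner_coef_wide _ (sr j)).
by apply: eq_bigr => k _; rewrite !mxE mulrC.
Qed.

Lemma vandermonde_neq0 (K : fieldType) (N : nat) :
  vandermonde (fun i : 'I_N => 'X_i : {mpoly K[N]}) != 0.
Proof.
apply/prodf_neq0 => i _; apply/prodf_neq0 => j ij; rewrite subr_eq0.
apply/eqP => /(congr1 (mcoeff U_(i)%MM)); rewrite !mcoeffX eqxx.
case: eqP => [/(congr1 (fun m : 'X_{1..N} => m i))|_ /eqP]; last by rewrite oner_eq0.
by rewrite !mnmE eqxx; case: eqP ij => // ->; rewrite ltnn.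
Qed.

Lemma msym_det (K : fieldType) (N : nat) (f : 'I_N -> nat) (s : 'S_N) :
  msym s (\det (\matrix_(i < N, j < N) 'X_i ^+ f j) : {mpoly K[N]})
  = (-1) ^+ s * \det (\matrix_(i < N, j < N) 'X_i ^+ f j).
Proof.
rewrite -det_map_mx -det_perm -det_mulmx; congr (\det _).
rewrite -row_permE.
by apply/matrixP => i j; rewrite !mxE rmorphXn /= [msym _ _]mmapX mmap1U.
Qed.


Lemma vandermondeN (A : comNzRingType) (N : nat) (x : 'I_N -> A) :
  vandermonde x = (\prod_(i < N) \prod_(j < N | (i < j)%N) -1) *
    \prod_(i < N) \prod_(j < N | (i < j)%N) (x j - x i).
Proof.
rewrite -big_split /=; apply: eq_bigr => i _; rewrite -big_split /=.
by apply: eq_bigr => j _; rewrite mulN1r opprB.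
Qed.

Lemma prodN1K (A : comNzRingType) (N : nat) :
  let e := \prod_(i < N) \prod_(j < N | (i < j)%N) (-1 : A) in e * e = 1.
Proof.
rewrite /= -big_split big1 //= => i _; rewrite -big_split big1 //= => j _.
by rewrite mulrNN mulr1.
Qed.

Lemma msym_vandermonde (K : fieldType) (N : nat) (s : 'S_N) :
  msym s (vandermonde (fun i : 'I_N => 'X_i : {mpoly K[N]}))
  = (-1) ^+ s * vandermonde (fun i : 'I_N => 'X_i).
Proof.
rewrite vandermondeN.
rewrite (_ : \prod_(i < N) \prod_(j < N | (i < j)%N) ('X_j - 'X_i)
   = \det (\matrix_(i < N, j < N) 'X_i ^+ j) :> {mpoly K[N]}).
  rewrite rmorphM /= msym_det mulrCA; congr (_ * (_ * _)).
  rewrite rmorph_prod; apply: eq_bigr => i _; rewrite rmorph_prod.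
  by apply: eq_bigr => j _; rewrite rmorphN1.
rewrite -det_tr (_ : _^T = Vandermonde N (\row_i 'X_i)); last first.
  by apply/matrixP => i j; rewrite !mxE.
rewrite det_Vandermonde; apply: eq_bigr => i _; apply: eq_bigr => j _.
by rewrite !mxE.
Qed.

Lemma schur_subproof (K : fieldType) (N : nat) (lam : N.-tuple nat) :
  exists s : sympoly N K,
    (s : {mpoly K[N]}) * vandermonde (fun i => 'X_i) == alternant K lam.
Proof.
have [c cE] := det_poly_eval (fun i : 'I_N => 'X_i : {mpoly K[N]})
  (fun j => 'X^(tnth lam j + (N - j.+1))).
set e : {mpoly K[N]} := \prod_(i < N) \prod_(j < N | (i < j)%N) -1.
have altE : c * e * vandermonde (fun i => 'X_i) = alternant K lam.
  rewrite vandermondeN -/e -mulrA [e * _]mulrA prodN1K mul1r -cE.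
  by congr (\det _); apply/matrixP => i j; rewrite !mxE hornerXn.
suff symc : c * e \is symmetric by exists (Sympoly symc); rewrite altE.
apply/issymP => s; apply: (mulIf (vandermonde_neq0 K N)); rewrite altE.
have: msym s (alternant K lam) = (-1) ^+ s * alternant K lam by exact: msym_det.
by rewrite -altE msymM msym_vandermonde mulrCA => /(can_inj (signrMK s)); rewrite altE.
Qed.

End VandermondeDivides.

(* The quotient alternant / vandermonde, which is exact in {mpoly K[N]}. *)
Definition schur (K : fieldType) (N : nat) (lam : N.-tuple nat) :
    sympoly N K :=
  xchoose (schur_subproof K lam).

Lemma schurE (K : fieldType) (N : nat) (lam : N.-tuple nat) :
  (schur K lam : {mpoly K[N]}) * vandermonde (fun i => 'X_i)
    = alternant K lam.
Proof. exact/eqP/(xchooseP (schur_subproof K lam)). Qed.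

Definition schur_bar (K : fieldType) (N : nat) (lam : N.-tuple nat) :
    sympoly N K :=
  (schur K lam : {mpoly K[N]}).@[fun=> 1]^-1 *: schur K lam.

(* q_lambda(z) = schur_bar lambda evaluated at (z, 1, ..., 1) *)
Definition schur_bar_z1 (K : fieldType) (m : nat) (lam : m.+1.-tuple nat)
    (z : K) : K :=
  (schur_bar K lam : {mpoly K[m.+1]}).@[fun i => if i == ord0 then z else 1].

Section EvalLast0.
Variables (m : nat) (K : fieldType).

Definition vars0 : m.+1.-tuple {mpoly K[m]} :=
  [tuple of rcons [tuple 'X_i | i < m] 0].

Lemma eval_last0_subproof (f : sympoly m.+1 K) :
  (f : {mpoly K[m.+1]}) \mPo vars0 \is symmetric.
Proof.
apply: msym_comp_poly (sympoly_sym f) _ => s.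
have -> : [tuple msym s vars0`_i | i < m.+1]
    = rcons [tuple 'X_(s i) | i < m] 0 :> seq {mpoly K[m]}.
  rewrite (_ : [tuple _ | i < _] = map_tuple (msym s) vars0); last first.
    by apply: eq_from_tnth => i; rewrite tnth_mktuple tnth_map (tnth_nth 0 vars0).
  rewrite /= map_rcons rmorph0; congr (rcons _ _); rewrite -map_comp.
  by apply: eq_map => i /=; rewrite /msym mmapX mmap1U.
rewrite /vars0 /= -!cats1 perm_cat2r perm_sym.
rewrite (map_comp (fun j : 'I_m => 'X_j : {mpoly K[m]}) s) perm_map //.
apply: uniq_perm.
- by rewrite map_inj_uniq -?enumT ?enum_uniq //; exact: perm_inj.
- exact: enum_uniq.
move=> i; rewrite mem_enum; apply/mapP; exists (s^-1%g i); rewrite ?mem_enum //.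
by rewrite permKV.
Qed.

(* (P f)(x_1, ..., x_m) = f(x_1, ..., x_m, 0) *)
Definition eval_last0 (f : sympoly m.+1 K) : sympoly m K :=
  Sympoly (eval_last0_subproof f).

Lemma eval_last0_is_linear : linear eval_last0.
Proof. by move=> a f g; apply: val_inj; rewrite /= linearP. Qed.

HB.instance Definition _ := GRing.isLinear.Build K (sympoly m.+1 K) (sympoly m K)
  _ eval_last0 eval_last0_is_linear.

End EvalLast0.

Section LebesgueTuple.
Local Open Scope ereal_scope.
Variable R : realType.
Local Notation rn n := (n.-tuple (measurableTypeR R)).

Definition tcons (n : nat) (p : rn n * measurableTypeR R) : rn n.+1 :=
  [tuple of p.2 :: p.1].

Lemma measurable_tcons n : measurable_fun [set: _] (@tcons n).
Proof. exact: measurable_cons. Qed.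

Definition lebesgue_cons (n : nat) (mu : {measure set (rn n) -> \bar R}) :
    set (rn n.+1) -> \bar R :=
  pushforward (mu \x @lebesgue_measure R) (@tcons n).

HB.instance Definition _ n (mu : {measure set (rn n) -> \bar R}) :=
  Measure.copy (lebesgue_cons mu)
    (measure_function_pushforward__canonical__measure_function_Measure
       (mu \x @lebesgue_measure R) (@measurable_tcons n)).

(* Lebesgue measure on R^n (on its Borel sigma-algebra), as an iterated
   product measure; see lebesgue_tuple_box. *)
Fixpoint lebesgue_tuple (n : nat) : {measure set (rn n) -> \bar R} :=
  match n with
  | 0 => dirac ([tuple] : rn 0)
  | n'.+1 => lebesgue_cons (lebesgue_tuple n')
  end.

Lemma lebesgue_tuple_box (n : nat) (A : 'I_n -> set (measurableTypeR R)) :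
  (forall i, measurable (A i)) ->
  lebesgue_tuple n [set x | forall i, A i (tnth x i)]
    = \prod_(i < n) lebesgue_measure (A i).
Proof.
elim: n => [|n IHn] in A * => mA.
  by rewrite big_ord0 /= /dirac indicE mem_set // => -[].
rewrite big_ord_recl muleC -IHn // /= /lebesgue_cons /pushforward.
have mB : measurable [set x : rn n | forall i, A (lift ord0 i) (tnth x i)].
  rewrite (_ : mkset _ = \bigcap_(i in [set: 'I_n])
      ((@tnth n (measurableTypeR R))^~ i @^-1` A (lift ord0 i))).
    apply: fin_bigcap_measurable => // i _; rewrite -[X in measurable X]setTI.
    exact: measurable_tnth.
  by apply/seteqP; split => x /= xA i; [move=> _|]; exact: xA.
rewrite -product_measure1E //; congr (_ _).
apply/seteqP; split => [[x t] /= xA|[x t] /= [xA tA] i].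
  by split => [i|]; [have := xA (lift ord0 i); rewrite tnthS|exact: (xA ord0)].
by case: (unliftP ord0 i) => [j ->|->]; rewrite ?tnthS //; exact: xA.
Qed.

End LebesgueTuple.

Definition Cintegral d (T : measurableType d) (R : realType)
    (mu : {measure set T -> \bar R}) (D : set T) (f : T -> R[i]) : R[i] :=
  ((\int[mu]_(x in D) complex.Re (f x)) +i*
   (\int[mu]_(x in D) complex.Im (f x)))%C.

Definition eval_real (R : realType) (n : nat) (f : sympoly n R[i])
    (y : n.-tuple R) : R[i] :=
  (f : {mpoly _[n]}).@[fun i => ((tnth y i)%:C)%C].

(* y_1 < x_1 < y_2 < ... < x_m < y_{m+1} *)
Definition interlacing (R : realType) (m : nat) (y : m.+1.-tuple R) :
    set (m.-tuple R) :=
  [set x | forall i : 'I_m,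
     tnth y (widen_ord (leqnSn m) i) < tnth x i < tnth y (lift ord0 i)].

(* Main.v *)
(* Expanding symmetric polynomials in Schur functions through the coefficients
   of f * Delta at the exponents lambda + delta, one gets a coordinate form
   [schur_coef] in which P forgets the lambda with lambda_n > 0, exactly those
   killed by Q_0 (there bar s_lambda(0, 1, ..., 1) = 0). Hence Q_0 factors through
   the surjection P, and the factor is determined.
   For the integral, Delta s_lambda is a determinant of monomials x_i^(l_j), which
   integrates over the box of interlacing points to
   det((y_(i+1)^(l_j + 1) - y_i^(l_j + 1)) / (l_j + 1)); undoing row differences,
   this is up to sign the alternant of (lambda, 0) divided by prod_j (l_j + 1),
   and Weyl's dimension formula identifies this product with
   (n-1)! s_(lambda, 0)(1) / s_lambda(1). *)
Require Import Defs.
From HB Require Import structures.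
From mathcomp Require Import all_boot all_order all_fingroup all_algebra.
From mathcomp Require Import complex.
From mathcomp Require Import mpoly.
From mathcomp Require Import all_classical all_reals all_analysis measurable_realfun.
From mathcomp Require Import zify ring.

Set Implicit Arguments.
Unset Strict Implicit.
Unset Printing Implicit Defensive.

Import Order.TTheory GRing.Theory Num.Theory.
Import numFieldNormedType.Exports.

Local Open Scope classical_set_scope.
Local Open Scope ring_scope.

(** * Alternants, coefficient extraction and the Schur expansion *)

(** The vector lambda + delta, encoded as a multinomial so that it can index coefficients. *)
Definition shifted (N : nat) (lam : N.-tuple nat) : 'X_{1..N} :=
  [multinom (tnth lam j + (N - j.+1))%N | j < N].

Lemma is_partitionP (N : nat) (lam : N.-tuple nat) :
  reflect (forall i j : 'I_N, (i <= j)%N -> (tnth lam j <= tnth lam i)%N)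
          (is_partition lam).
Proof.
have geq_trans : transitive geq by move=> a b c /= ba cb; apply: leq_trans cb ba.
apply: (iffP idP) => [/(sorted_leq_nth geq_trans leqnn 0%N) lamP i j ij|lamP].
  by rewrite !(tnth_nth 0%N); apply: lamP; rewrite // inE size_tuple.
apply/(sortedP 0%N) => i; rewrite size_tuple => iN.
have := lamP (Ordinal (ltnW iN)) (Ordinal iN) (leqnSn i).
by rewrite !(tnth_nth 0%N).
Qed.

Lemma shifted_decreasing (N : nat) (lam : N.-tuple nat) (i j : 'I_N) :
  is_partition lam -> (i < j)%N -> (shifted lam j < shifted lam i)%N.
Proof.
move=> /is_partitionP lamP ij; rewrite !mnmE.
by have := lamP _ _ (ltnW ij); have := ltn_ord j; lia.
Qed.

Lemma shifted_inj (N : nat) : injective (@shifted N).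
Proof.
move=> lam mu /mnmP e; apply: eq_from_tnth => i.
by have := e i; rewrite !mnmE => /addIn.
Qed.

(** Strictly decreasing naturals drop by at least one per step, so m dominates the staircase delta,
    and m - delta is still weakly decreasing. *)
Lemma decreasing_eq_shifted (N : nat) (m : 'X_{1..N}) :
  (forall i j : 'I_N, (i < j)%N -> (m j < m i)%N) ->
  exists2 lam, is_partition lam & m = shifted lam.
Proof.
move=> mdec.
have mge (i j : 'I_N) : (i <= j)%N -> (m j + (j - i) <= m i)%N.
  case: i j => i iN [j jN] /= ij; elim: j => [|j IHj] in jN ij *.
    by move: ij; rewrite leqn0 => /eqP ?; subst i; rewrite addn0 (bool_irrelevance iN jN).
  move: ij; rewrite leq_eqVlt => /predU1P[?|].
    by subst i; rewrite subnn addn0 (bool_irrelevance iN jN).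
  rewrite ltnS => ij; apply: leq_trans (IHj (ltnW jN) ij).
  by rewrite subSn // addnS -addSn leq_add2r; apply: mdec => /=.
have mgeN (i : 'I_N) : (N - i.+1 <= m i)%N.
  have N0 : (N.-1 < N)%N by rewrite prednK // (leq_trans _ (ltn_ord i)).
  have iN : (i <= Ordinal N0)%N by rewrite -ltnS prednK // (leq_trans _ (ltn_ord i)).
  by apply: leq_trans (mge _ _ iN); rewrite subnS -subn1 subnAC subn1 leq_addl.
exists [tuple (m i - (N - i.+1))%N | i < N].
  apply/is_partitionP => i j ij; rewrite !tnth_mktuple.
  by have := mge _ _ ij; have := ltn_ord j; lia.
by apply/mnmP => i; rewrite !mnmE tnth_mktuple subnK.
Qed.

Lemma alternant_Leibniz (K : fieldType) (N : nat) (lam : N.-tuple nat) :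
  alternant K lam =
    \sum_(s : 'S_N) (-1) ^+ s *: 'X_[[multinom shifted lam (s i) | i < N]].
Proof.
apply: eq_bigr => s _; rewrite -[RHS]mul_mpolyC rmorphXn rmorphN1; congr (_ * _).
rewrite mpolyXE_id; apply: eq_bigr => i _.
by rewrite !mxE !mnmE.
Qed.

(** Such an s is increasing, and so is its inverse. An increasing self-map t of ['I_N] satisfies i
    <= t i; used for both, this forces s i = i. *)
Lemma decreasing_perm_eq1 (N : nat) (a b : 'I_N -> nat) (s : 'S_N) :
  (forall i j : 'I_N, (i < j)%N -> (a j < a i)%N) ->
  (forall i j : 'I_N, (i < j)%N -> (b j < b i)%N) ->
  (forall i, a (s i) = b i) -> s = 1%g.
Proof.
move=> adec bdec ab.
have smono (i j : 'I_N) : (i < j)%N -> (s i < s j)%N.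
  move=> ij; rewrite ltnNge; apply/negP; rewrite leq_eqVlt => /predU1P[/val_inj/perm_inj e|].
    by rewrite e ltnn in ij.
  by move=> /adec; rewrite !ab ltnNge ltnW ?bdec.
have sge (t : 'S_N) : (forall i j : 'I_N, (i < j)%N -> (t i < t j)%N) ->
    forall i : 'I_N, (i <= t i)%N.
  move=> tmono [i iN]; elim: i => // i IHi in iN *.
  apply: leq_ltn_trans (IHi (ltnW iN)) _; exact: tmono.
have sVmono (i j : 'I_N) : (i < j)%N -> ((s^-1)%g i < (s^-1)%g j)%N.
  move=> ij; rewrite ltnNge; apply/negP; rewrite leq_eqVlt => /predU1P[/val_inj/perm_inj e|].
    by rewrite e ltnn in ij.
  by move=> /smono; rewrite !permKV ltnNge ltnW.
apply/permP => i; rewrite perm1; apply/val_inj/eqP; rewrite /= eqn_leq sge // andbT.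
by have := sge _ sVmono (s i); rewrite permK.
Qed.

(** In the Leibniz expansion only the identity permutation can produce a strictly decreasing
    exponent. *)
Lemma mcoeff_alternant (K : fieldType) (N : nat) (lam mu : N.-tuple nat) :
  is_partition lam -> is_partition mu ->
  (alternant K lam)@_(shifted mu) = (lam == mu)%:R.
Proof.
move=> plam pmu; rewrite alternant_Leibniz linear_sum /= (bigD1 1%g) //=.
rewrite big1 => [|s s1]; rewrite mcoeffZ mcoeffX.
  rewrite odd_perm1 mul1r addr0 -(inj_eq (@shifted_inj N)); congr (_ == _)%:R.
  by apply/mnmP => i; rewrite mnmE perm1.
case: eqP => [/mnmP e|]; last by rewrite mulr0.
move/eqP: s1; case; apply: (@decreasing_perm_eq1 _ (shifted lam) (shifted mu)).
- by move=> i j; exact: shifted_decreasing.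
- by move=> i j; exact: shifted_decreasing.
by move=> i; rewrite -e mnmE.
Qed.

(** At an exponent with two equal entries, a transposition makes the coefficient its own negative.
    Any other exponent can be permuted, at the cost of a sign, into some lambda + delta. *)
Lemma antisymmetric_eq0 (K : numFieldType) (N : nat) (h : {mpoly K[N]}) :
  (forall s : 'S_N, msym s h = (-1) ^+ s * h) ->
  (forall lam : N.-tuple nat, is_partition lam -> h@_(shifted lam) = 0) ->
  h = 0.
Proof.
move=> hanti h0; apply/mpolyP => m; rewrite mcoeff0.
have hs (s : 'S_N) : h@_[multinom m (s i) | i < N] = (-1) ^+ s * h@_m.
  by rewrite -mcoeff_sym hanti -(rmorphN1 (@mpolyC N K)) -rmorphXn mul_mpolyC mcoeffZ.
have [/injectiveP minj|/injectivePn[i [j ij mij]]] := boolP (injectiveb m); last first.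
  have := hs (tperm i j); rewrite odd_tperm ij mulN1r.
  rewrite (_ : [multinom _ | _ < _] = m).
    by move/eqP; rewrite eq_sym eqNr => /eqP.
  by apply/mnmP => k; rewrite mnmE; case: tpermP => [->|->|].
(* Sorting gives a weakly decreasing rearrangement; injectivity of m makes it strict. *)
have [s sE] : exists s : 'S_N, forall i j : 'I_N, (i < j)%N -> (m (s j) < m (s i))%N.
  pose t := sort geq [tuple m i | i < N].
  have /tuple_permP[s tE] : perm_eq t [tuple m i | i < N] by rewrite perm_sort.
  exists s => i j ij.
  have tnthE (k : 'I_N) : nth 0%N t k = m (s k).
    rewrite tE (nth_map k) ?size_enum_ord // nth_ord_enum tnth_mktuple //.
  have ut : uniq t by rewrite sort_uniq map_inj_uniq ?enum_uniq.
  have geq_trans : transitive geq by move=> a b c /= ba cb; apply: leq_trans cb ba.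
  have szt : size t = N by rewrite size_sort size_tuple.
  have : (m (s j) <= m (s i))%N.
    rewrite -!tnthE; apply: (sorted_leq_nth geq_trans leqnn 0%N);
      rewrite ?inE ?szt //; last exact: ltnW.
    by apply: sort_sorted => a b; exact: leq_total.
  rewrite leq_eqVlt => /predU1P[/minj/perm_inj e|//].
  by rewrite e ltnn in ij.
have [lam plam lamE] : exists2 lam, is_partition lam &
    [multinom m (s i) | i < N] = shifted lam.
  by apply: decreasing_eq_shifted => i j ij; rewrite !mnmE sE.
apply: (can_inj (signrMK s)); rewrite mulr0 -hs lamE h0 //.
Qed.

(** The coordinate of f along s_lambda: f * Delta is a combination of alternants, and the alternant
    of lambda is the only one containing the monomial lambda + delta. *)
Definition schur_coef (K : fieldType) (N : nat) (lam : N.-tuple nat)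
    (f : sympoly N K) : K :=
  ((f : {mpoly K[N]}) * vandermonde (fun i => 'X_i))@_(shifted lam).

Lemma schur_coef_is_scalar (K : fieldType) (N : nat) (lam : N.-tuple nat) :
  scalar (schur_coef lam : sympoly N K -> K).
Proof.
by move=> a f g; rewrite /schur_coef /= mulrDl -scalerAl mcoeffD mcoeffZ.
Qed.

HB.instance Definition _ (K : fieldType) (N : nat) (lam : N.-tuple nat) :=
  GRing.isLinear.Build K (sympoly N K) K *%R (schur_coef lam)
    (@schur_coef_is_scalar K N lam).

Lemma schur_coef_schur (K : fieldType) (N : nat) (lam mu : N.-tuple nat) :
  is_partition lam -> is_partition mu ->
  schur_coef lam (schur K mu) = (mu == lam)%:R.
Proof. by move=> plam pmu; rewrite /schur_coef schurE mcoeff_alternant. Qed.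

Lemma schur_coef_eq0 (K : numFieldType) (N : nat) (f : sympoly N K) :
  (forall lam, is_partition lam -> schur_coef lam f = 0) -> f = 0.
Proof.
move=> f0; apply/val_inj/(mulIf (vandermonde_neq0 K N)); rewrite mul0r.
apply: antisymmetric_eq0 => // s.
by rewrite msymM msym_vandermonde (issymP _ (sympoly_sym f)) mulrCA.
Qed.

Lemma schur_expansion (K : numFieldType) (N : nat) (f : sympoly N K) :
  exists2 r : seq (N.-tuple nat), all (@is_partition N) r &
    f = \sum_(lam <- r) schur_coef lam f *: schur K lam.
Proof.
(* Truncated subtraction makes this only a left inverse of [shifted]. That suffices: [r] has to
   contain every partition with nonzero coordinate, and further partitions do no harm. *)
pose unshift (m : 'X_{1..N}) := [tuple (m i - (N - i.+1))%N | i < N].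
have shiftedK : cancel (@shifted N) unshift.
  by move=> lam; apply: eq_from_tnth => i; rewrite tnth_mktuple mnmE addnK.
pose r := [seq lam <- undup (map unshift
  (msupp ((f : {mpoly K[N]}) * vandermonde (fun i => 'X_i)))) | is_partition lam].
have rP : all (@is_partition N) r by rewrite filter_all.
exists r => //; apply/eqP; rewrite -subr_eq0; apply/eqP.
apply: schur_coef_eq0 => lam plam; rewrite linearB linear_sum /=.
have [lamr|lamr] := boolP (lam \in r).
  rewrite (bigD1_seq lam) ?filter_uniq ?undup_uniq //= big_seq_cond big1.
    by rewrite linearZ /= schur_coef_schur // eqxx mulr1 addr0 subrr.
  move=> mu /andP[/(allP rP) pmu /negPf mulam].
  by rewrite linearZ /= schur_coef_schur // mulam mulr0.
rewrite big_seq big1 ?subr0 => [|mu mur]; last first.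
  rewrite linearZ /= schur_coef_schur ?(allP rP _ mur) //.
  by case: eqP mur lamr => [->->//|]; rewrite mulr0.
apply: memN_msupp_eq0; apply: contra lamr => lamf.
by rewrite mem_filter plam mem_undup -[lam]shiftedK map_f.
Qed.

(** * Schur functions at x_n = 0 *)

Section EvalLast0Schur.
Variables (m : nat) (K : fieldType).

Let vars0_widen (i : 'I_m) :
  tnth (vars0 m K) (widen_ord (leqnSn m) i) = 'X_i.
Proof.
by rewrite (tnth_nth 0) /= nth_rcons size_map size_enum_ord ltn_ord
  (nth_map i) ?size_enum_ord ?ltn_ord // nth_ord_enum.
Qed.

Let vars0_max : tnth (vars0 m K) ord_max = 0.
Proof.
by rewrite (tnth_nth 0) /= nth_rcons size_map size_enum_ord ltnn eqxx.
Qed.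

Lemma vandermonde_recr (A : comNzRingType) (x : 'I_m.+1 -> A) :
  vandermonde x = vandermonde (fun i => x (widen_ord (leqnSn m) i)) *
    \prod_(i < m) (x (widen_ord (leqnSn m) i) - x ord_max).
Proof.
rewrite /vandermonde big_ord_recr /= [X in _ * X]big1 => [|j]; last first.
  by move=> /leq_trans /(_ (leq_ord j)); rewrite ltnn.
rewrite mulr1 -big_split /=; apply: eq_bigr => i _.
by rewrite big_mkcond big_ord_recr /= -big_mkcond /= ltn_ord.
Qed.

Lemma vandermonde_vars0 :
  vandermonde (tnth (vars0 m K)) =
    vandermonde (fun i => 'X_i) * \prod_(i < m) 'X_i.
Proof.
rewrite vandermonde_recr vars0_max; congr (_ * _).
  by congr vandermonde; apply/funext => i; rewrite vars0_widen.
by apply: eq_bigr => i _; rewrite vars0_widen subr0.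
Qed.

(** The substitution is made in the identity with cleared denominator; Delta becomes a product that
    is still nonzero, hence can be cancelled afterwards. *)
Lemma eval_last0_schurE (lam : m.+1.-tuple nat) :
  (eval_last0 (schur K lam) : {mpoly K[m]}) *
    (vandermonde (fun i => 'X_i) * \prod_(i < m) 'X_i) =
  \det (\matrix_(i < m.+1, j < m.+1)
     tnth (vars0 m K) i ^+ (tnth lam j + (m.+1 - j.+1))).
Proof.
rewrite -vandermonde_vars0 /=.
have -> : vandermonde (tnth (vars0 m K)) =
    vandermonde (fun i => 'X_i : {mpoly K[m.+1]}) \mPo vars0 m K.
  rewrite /vandermonde rmorph_prod; apply: eq_bigr => i _.
  rewrite rmorph_prod; apply: eq_bigr => j _.
  by rewrite rmorphB /= !comp_mpolyXU !(tnth_nth 0).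
rewrite -rmorphM schurE -det_map_mx; congr (\det _); apply/matrixP => i j.
by rewrite !mxE rmorphXn /= comp_mpolyXU (tnth_nth (0 : {mpoly K[m]})).
Qed.

Lemma vandermonde_vars0_neq0 :
  vandermonde (fun i => 'X_i) * \prod_(i < m) 'X_i != 0 :> {mpoly K[m]}.
Proof.
rewrite mulf_neq0 ?vandermonde_neq0 //; apply/prodf_neq0 => i _.
by rewrite -msupp_eq0 msuppX.
Qed.

(** All exponents in the last row are positive, so at 0 this row of the determinant vanishes. *)
Lemma eval_last0_schur_gt0 (lam : m.+1.-tuple nat) :
  (0 < tnth lam ord_max)%N -> eval_last0 (schur K lam) = 0.
Proof.
move=> lam0; apply/val_inj/(mulIf vandermonde_vars0_neq0).
rewrite /= eval_last0_schurE mul0r (expand_det_row _ ord_max) big1 // => j _.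
rewrite mxE vars0_max expr0n; case: eqP; rewrite ?mul0r // => j0.
have jm : j = ord_max by apply: val_inj => /=; have := ltn_ord j; lia.
by move: j0 lam0; rewrite jm; lia.
Qed.

(** The last row becomes (0, ..., 0, 1), and the remaining minor is the alternant of lambda times
    the product of the x_i that appears in the denominator. *)
Lemma eval_last0_schur_rcons (lam : m.-tuple nat) :
  eval_last0 (schur K [tuple of rcons lam 0%N]) = schur K lam.
Proof.
apply/val_inj/(mulIf vandermonde_vars0_neq0).
rewrite /= eval_last0_schurE mulrA schurE (expand_det_row _ ord_max).
have rcE (j : 'I_m) : tnth [tuple of rcons lam 0%N] (widen_ord (leqnSn m) j) = tnth lam j.
  by rewrite !(tnth_nth 0%N) /= nth_rcons size_tuple ltn_ord.
have rcM : tnth [tuple of rcons lam 0%N] ord_max = 0%N.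
  by rewrite (tnth_nth 0%N) /= nth_rcons size_tuple ltnn eqxx.
rewrite (bigD1 ord_max) //= big1 ?addr0 => [|j jmax]; last first.
  have jm : (j < m)%N by rewrite ltn_neqAle -ltnS ltn_ord andbT.
  by rewrite mxE vars0_max expr0n addn_eq0 subSS subn_eq0 [(m <= j)%N]leqNgt jm andbF mul0r.
rewrite mxE vars0_max rcM subnn expr0 mul1r /cofactor.
rewrite -signr_odd oddD addbb expr0 mul1r.
(* With one more variable every exponent in the minor is larger by one; the diagonal matrix takes
   the extra x_i out of row i. *)
have -> : row' ord_max (col' ord_max (\matrix_(i < m.+1, j < m.+1)
     tnth (vars0 m K) i ^+ (tnth [tuple of rcons lam 0%N] j + (m.+1 - j.+1)))) =
  diag_mx (\row_i 'X_i) *m \matrix_(i < m, j < m) 'X_i ^+ (tnth lam j + (m - j.+1)).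
  apply/matrixP => i j; rewrite mul_diag_mx !mxE -exprS.
  have liftE (k : 'I_m) : lift ord_max k = widen_ord (leqnSn m) k.
    by apply: val_inj; rewrite /= /bump leqNgt ltn_ord.
  rewrite !liftE vars0_widen rcE /=; by rewrite -addnS subSS subnSK.
rewrite det_mulmx det_diag mulrC; congr (_ * _).
by apply: eq_bigr => i _; rewrite mxE.
Qed.

End EvalLast0Schur.

(* The principal specialisation x_i = q^i turns the alternant into a second
   Vandermonde determinant; dividing both by a power of q - 1 and setting q = 1
   gives Weyl's dimension formula. *)
Lemma schur_dimension (K : fieldType) (N : nat) (lam : N.-tuple nat) :
  (schur K lam : {mpoly K[N]}).@[fun=> 1] *
      vandermonde (fun i : 'I_N => (i : nat)%:R) =
    vandermonde (fun i => - (shifted lam i)%:R).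
Proof.
(* The quotient (X^a - 1)/(X - 1), whose value at 1 is a. *)
pose geom a : {poly K} := \sum_(i < a) 'X^i.
have geom1 a : (geom a).[1] = a%:R.
  rewrite horner_sum (eq_bigr (fun=> 1)) ?sumr_const ?card_ord // => i _.
  by rewrite hornerXn expr1n.
have geomB a b : 'X^a - 'X^b = ('X - 1) * (geom a - geom b).
  by rewrite mulrBr -!subrX1 opprB addrA subrK.
pose q i : {poly K} := 'X^(nat_of_ord i).
pose s : {poly K} := mmap (@polyC K) (q N) (schur K lam).
(* The entries are negated because [det_Vandermonde] multiplies the differences x_j - x_i, while
   [vandermonde] uses x_i - x_j. *)
have sE : s * vandermonde (q N) =
    vandermonde (fun i => - 'X^(shifted lam i)).
  have -> : vandermonde (q N) =
      mmap (@polyC K) (q N) (vandermonde (fun i => 'X_i)).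
    rewrite /vandermonde rmorph_prod; apply: eq_bigr => i _.
    rewrite rmorph_prod; apply: eq_bigr => j _.
    by rewrite rmorphB /= !mmapX !mmap1U.
  rewrite -rmorphM schurE /alternant -det_map_mx.
  transitivity (\det (Vandermonde N (\row_j 'X^(shifted lam j) : 'rV[{poly K}]_N))).
    congr (\det _); apply/matrixP => i j; rewrite !mxE rmorphXn /= mmapX mmap1U.
    by rewrite mnmE -!exprM mulnC.
  rewrite det_Vandermonde; apply: eq_bigr => i _; apply: eq_bigr => j _.
  by rewrite !mxE opprK addrC.
pose e : {poly K} := \prod_(i < N) \prod_(j < N | (i < j)%N) ('X - 1).
have e0 : e != 0.
  by apply/prodf_neq0 => i _; apply/prodf_neq0 => j _; rewrite polyXsubC_eq0.
have vE (a : 'I_N -> nat) : vandermonde (fun i => 'X^(a i)) =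
    e * vandermonde (fun i => geom (a i)).
  rewrite /vandermonde -big_split; apply: eq_bigr => i _ /=.
  by rewrite -big_split; apply: eq_bigr => j _ /=; rewrite geomB.
have vNE (a : 'I_N -> nat) : vandermonde (fun i => - 'X^(a i)) =
    e * vandermonde (fun i => - geom (a i)).
  rewrite /vandermonde -big_split; apply: eq_bigr => i _ /=.
  rewrite -big_split; apply: eq_bigr => j _ /=.
  by rewrite opprK addrC geomB opprK [- _ + _]addrC.
move: sE; rewrite vNE [vandermonde (q N)]vE mulrCA => /(mulfI e0).
move=> /(congr1 (horner^~ 1)); rewrite hornerM.
have -> : s.[1] = (schur K lam : {mpoly K[N]}).@[fun=> 1].
  rewrite /s mevalE /mmap horner_sum; apply: eq_bigr => mm _.
  rewrite hornerCM; congr (_ * _); rewrite /mmap1 horner_prod.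
  by apply: eq_bigr => i _; rewrite -exprM hornerXn !expr1n.
have vh (f : 'I_N -> {poly K}) : (vandermonde f).[1] = vandermonde (fun i => (f i).[1]).
  rewrite /vandermonde horner_prod; apply: eq_bigr => i _.
  by rewrite horner_prod; apply: eq_bigr => j _; rewrite hornerD hornerN.
rewrite !vh (_ : (fun i : 'I_N => (geom i).[1]) = (fun i => (i : nat)%:R)).
  by move=> ->; congr vandermonde; apply/funext => i; rewrite hornerN geom1.
by apply/funext => i; rewrite geom1.
Qed.

Lemma vandermonde_neq0_inj (K : fieldType) (N : nat) (x : 'I_N -> K) :
  injective x -> vandermonde x != 0.
Proof.
move=> xinj; apply/prodf_neq0 => i _; apply/prodf_neq0 => j ij.
by rewrite subr_eq0; apply/eqP => /xinj e; rewrite e ltnn in ij.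
Qed.

Lemma shifted_index_inj (N : nat) (lam : N.-tuple nat) :
  is_partition lam -> injective (shifted lam).
Proof.
move=> plam i j e; apply/val_inj; case: (ltngtP i j) => //= ij.
  by have := shifted_decreasing plam ij; rewrite e ltnn.
by have := shifted_decreasing plam ij; rewrite e ltnn.
Qed.

(** The shifted parts are distinct, so in characteristic 0 the right side of the dimension formula
    is nonzero. *)
Lemma schur_1_neq0 (K : numFieldType) (N : nat) (lam : N.-tuple nat) :
  is_partition lam -> (schur K lam : {mpoly K[N]}).@[fun=> 1] != 0.
Proof.
move=> plam; have := schur_dimension K lam; apply: contra_eq_neq => ->.
rewrite mul0r eq_sym vandermonde_neq0_inj // => i j /oppr_inj /eqP.
by rewrite eqr_nat => /eqP /(shifted_index_inj plam).
Qed.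

(** Compare the dimension formulas of lambda and (lambda, 0). The old shifted parts all rise by one,
    which leaves their differences unchanged; the new shifted part 0 contributes the factors l_j +
    1, and the new index m contributes (-1)^m m! on the other side. *)
Lemma schur_rcons_1 (K : numFieldType) (m : nat) (lam : m.-tuple nat) :
  (schur K [tuple of rcons lam 0%N] : {mpoly K[m.+1]}).@[fun=> 1] * m`!%:R =
  (schur K lam : {mpoly K[m]}).@[fun=> 1] * \prod_(i < m) (shifted lam i).+1%:R.
Proof.
have V0 : vandermonde (fun i : 'I_m => (i : nat)%:R : K) != 0.
  by apply: vandermonde_neq0_inj => i j /eqP; rewrite eqr_nat => /eqP /val_inj.
have N0 : (-1) ^+ m != 0 :> K by rewrite expf_neq0 // oppr_eq0 oner_eq0.
apply/(mulIf V0)/(mulIf N0).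
have facE : m`!%:R * (-1) ^+ m = \prod_(i < m) ((i : nat)%:R - m%:R) :> K.
  rewrite fact_prod big_add1 /= big_mkord (reindex_inj rev_ord_inj) /=.
  rewrite natr_prod mulrC -[m in _ ^+ m]card_ord -prodr_const -big_split /=.
  apply: eq_bigr => i _; rewrite mulN1r subnSK // natrB ?opprB //; exact: ltnW.
have rcW (i : 'I_m) : shifted [tuple of rcons lam 0%N] (widen_ord (leqnSn m) i) =
    (shifted lam i).+1.
  by rewrite !mnmE !(tnth_nth 0%N) /= nth_rcons size_tuple ltn_ord -addnS subSS subnSK.
have rcM : shifted [tuple of rcons lam 0%N] ord_max = 0%N.
  by rewrite !mnmE !(tnth_nth 0%N) /= nth_rcons size_tuple ltnn eqxx subnn.
have := schur_dimension K [tuple of rcons lam 0%N].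
rewrite !vandermonde_recr /= -facE rcM.
have -> : vandermonde (fun i : 'I_m =>
      - (shifted [tuple of rcons lam 0%N] (widen_ord (leqnSn m) i))%:R : K) =
    vandermonde (fun i => - (shifted lam i)%:R).
  apply: eq_bigr => i _; apply: eq_bigr => j _; rewrite !rcW -!natr1.
  by rewrite !opprD !opprK addrACA addNr addr0.
rewrite -(schur_dimension K lam).
under eq_bigr => i _ do rewrite rcW oppr0 subr0 -mulN1r.
rewrite big_split /= prodr_const card_ord => e.
by rewrite -!mulrA [m`!%:R * _]mulrCA e; ring.
Qed.

(** * Factoring Q_0 through P *)

Lemma meval_msym (K : fieldType) (N : nat) (s : 'S_N) (p : {mpoly K[N]})
    (v : 'I_N -> K) : (msym s p).@[v] = p.@[fun i => v (s i)].
Proof.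
rewrite -[msym s p]comp_mpoly_id msym_mPo comp_mpoly_meval.
by apply: meval_eq => i; rewrite !tnth_mktuple mevalXU.
Qed.

(** P puts the zero in the last slot and [schur_bar_z1] puts z in the first; symmetry under their
    transposition reconciles the two. *)
Lemma meval_eval_last0 (K : fieldType) (m : nat) (f : sympoly m.+1 K) :
  (eval_last0 f : {mpoly K[m]}).@[fun=> 1] =
  (f : {mpoly K[m.+1]}).@[fun i => if i == ord0 then 0 else 1].
Proof.
rewrite /= comp_mpoly_meval.
rewrite -[in RHS](issymP _ (sympoly_sym f) (tperm ord0 ord_max)) meval_msym.
apply: meval_eq => i; rewrite -[X in tperm _ _ _ == X](tpermR ord0 ord_max).
rewrite (inj_eq perm_inj) (tnth_nth 0) /= nth_rcons size_map size_enum_ord.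
have [->|imax] := eqVneq i ord_max; first by rewrite ltnn eqxx meval0.
have im : (i < m)%N by rewrite ltn_neqAle -ltnS ltn_ord andbT.
by rewrite im (nth_map (Ordinal im)) ?size_enum_ord // mevalXU.
Qed.

Lemma partition_last0 (m : nat) (lam : m.+1.-tuple nat) :
  is_partition lam -> tnth lam ord_max = 0%N ->
  exists2 mu : m.-tuple nat, is_partition mu & lam = [tuple of rcons mu 0%N].
Proof.
move=> /is_partitionP plam lam0.
exists [tuple tnth lam (widen_ord (leqnSn m) i) | i < m].
  by apply/is_partitionP => i j ij; rewrite !tnth_mktuple plam.
apply: eq_from_tnth => i; rewrite [RHS](tnth_nth 0%N) /= nth_rcons size_map size_enum_ord.
case: (ltngtP i m) => [im|mi|im].
- rewrite (nth_map (Ordinal im)) ?size_enum_ord //; congr tnth; apply: val_inj.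
  by rewrite /= nth_enum_ord.
- by have := leq_ord i; rewrite leqNgt mi.
by rewrite -lam0; congr tnth; apply: val_inj.
Qed.

Lemma is_partition_rcons0 (m : nat) (lam : m.-tuple nat) :
  is_partition lam -> is_partition [tuple of rcons lam 0%N].
Proof.
by case: lam => -[|a s] sz; rewrite /is_partition //= rcons_path => ->.
Qed.

(** Ties the eigenvalue of Q_0 to P: it vanishes as soon as P kills s_lambda. *)
Lemma schur_bar_z1_0 (K : fieldType) (m : nat) (lam : m.+1.-tuple nat) :
  schur_bar_z1 lam 0 = (schur K lam : {mpoly K[m.+1]}).@[fun=> 1]^-1 *
    (eval_last0 (schur K lam) : {mpoly K[m]}).@[fun=> 1].
Proof. by rewrite meval_eval_last0 /schur_bar_z1 /= mevalZ. Qed.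

(** P sends each s_nu to 0 or, when nu ends in 0, to the Schur function of the truncated partition,
    so it merely forgets coordinates. *)
Lemma schur_coef_eval_last0 (K : numFieldType) (m : nat) (f : sympoly m.+1 K)
    (mu : m.-tuple nat) : is_partition mu ->
  schur_coef mu (eval_last0 f) = schur_coef [tuple of rcons mu 0%N] f.
Proof.
move=> pmu; have [r /allP rP ->] := schur_expansion f.
rewrite !linear_sum /= !big_seq; apply: eq_bigr => nu /rP pnu.
rewrite !linearZ /= schur_coef_schur ?is_partition_rcons0 //; congr (_ * _).
have [nu0|nu0] := posnP (tnth nu ord_max); last first.
  rewrite eval_last0_schur_gt0 // linear0; case: eqP => // nuE.
  by move: nu0; rewrite nuE (tnth_nth 0%N) /= nth_rcons size_tuple ltnn eqxx.
have [nu' pnu' ->] := partition_last0 pnu nu0.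
rewrite eval_last0_schur_rcons schur_coef_schur //; congr (nat_of_bool _)%:R.
by apply/eqP/eqP => [->//|/(congr1 val) /rcons_inj[/val_inj]].
Qed.

Lemma eval_last0_surj (K : numFieldType) (m : nat) (g : sympoly m K) :
  exists f : sympoly m.+1 K, eval_last0 f = g.
Proof.
have [r _ gE] := schur_expansion g.
exists (\sum_(lam <- r) schur_coef lam g *: schur K [tuple of rcons lam 0%N]).
rewrite [RHS]gE linear_sum; apply: eq_bigr => lam _.
by rewrite linearZ /= eval_last0_schur_rcons.
Qed.

(** L is T composed with a set-theoretic section of P. The section need not be linear: T takes the
    same value on all preimages of a point. *)
Lemma linear_factor (K : pzRingType) (U V W : lmodType K) (P : {linear U -> V})
    (T : {linear U -> W}) :
  (forall v, exists u, P u = v) -> (forall u, P u = 0 -> T u = 0) ->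
  exists L : {linear V -> W}, forall u, T u = L (P u).
Proof.
move=> Psurj PT; pose S v := projT1 (cid (Psurj v)).
have SK v : P (S v) = v by rewrite /S; case: cid.
have TS u : T u = T (S (P u)).
  by apply/eqP; rewrite -subr_eq0 -linearB PT // linearB /= SK subrr.
have Tlin : linear (T \o S).
  by move=> a v w /=; rewrite -linearP [RHS]TS linearP !SK.
pose L : {linear V -> W} := HB.pack (T \o S) (GRing.isLinear.Build _ _ _ _ _ Tlin).
by exists L.
Qed.

Section Factorization.
Variables (K : numFieldType) (m : nat).
Variable T : {linear sympoly m.+1 K -> sympoly m.+1 K}.
Hypothesis T_schur_bar : forall lam : m.+1.-tuple nat, is_partition lam ->
  T (schur_bar K lam) = schur_bar_z1 lam 0 *: schur_bar K lam.

Let T_schur (lam : m.+1.-tuple nat) : is_partition lam ->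
  T (schur K lam) = schur_bar_z1 lam 0 *: schur K lam.
Proof.
move=> plam; have := T_schur_bar plam; rewrite /schur_bar linearZ /= scalerA mulrC -scalerA.
by apply: scalerI; rewrite invr_eq0 schur_1_neq0.
Qed.

(** In the expansion of f, terms with positive last part have eigenvalue 0, and the other
    coefficients are coordinates of P f, hence 0. *)
Lemma eval_last0_ker f : eval_last0 f = 0 -> T f = 0.
Proof.
move=> f0; have [r /allP rP ->] := schur_expansion f.
rewrite linear_sum big_seq big1 //= => lam /rP plam; rewrite linearZ /= T_schur //.
have [lam0|lam0] := posnP (tnth lam ord_max); last first.
  by rewrite schur_bar_z1_0 eval_last0_schur_gt0 // meval0 mulr0 scale0r scaler0.
have [mu pmu ->] := partition_last0 plam lam0.
by rewrite -schur_coef_eval_last0 // f0 linear0 scale0r.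
Qed.

(** Apply T to s_(lambda, 0), a preimage of s_lambda under P. Its eigenvalue s_lambda(1) /
    s_(lambda, 0)(1) is exactly the change of normalisation. *)
Lemma factor_schur_bar (L : {linear sympoly m K -> sympoly m.+1 K}) :
  (forall f, T f = L (eval_last0 f)) ->
  forall lam : m.-tuple nat, is_partition lam ->
    L (schur_bar K lam) = schur_bar K [tuple of rcons lam 0%N].
Proof.
move=> TL lam plam; rewrite /schur_bar linearZ /= -eval_last0_schur_rcons -TL.
rewrite T_schur ?is_partition_rcons0 // scalerA schur_bar_z1_0; congr (_ *: _).
by rewrite eval_last0_schur_rcons mulrC mulfK ?schur_1_neq0.
Qed.

End Factorization.

(** * Integrals of product functions for Lebesgue measure on R^n *)

Lemma measurable_box (d : measure_display) (T : measurableType d) (n : nat)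
    (A : 'I_n -> set T) :
  (forall i, measurable (A i)) ->
  measurable [set x : n.-tuple T | forall i, A i (tnth x i)].
Proof.
move=> mA; rewrite (_ : mkset _ = \bigcap_(i in [set: 'I_n])
    ((@tnth n T)^~ i @^-1` A i)).
  apply: fin_bigcap_measurable => // i _; rewrite -[X in measurable X]setTI.
  exact: measurable_tnth.
by apply/seteqP; split => x /= xA i; [move=> _|]; exact: xA.
Qed.

(** The open cubes of half-side k exhaust the space; sigma-finiteness is what Fubini will require of
    the first n coordinates. *)
Lemma lebesgue_tuple_sigma_finite (R : realType) (n : nat) :
  sigma_finite [set: n.-tuple (measurableTypeR R)] (lebesgue_tuple R n).
Proof.
pose I k : set (measurableTypeR R) := [set` `]- k%:R, k%:R[%R].
have mI k (i : 'I_n) : measurable (I k) by exact: measurable_itv.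
exists (fun k => [set x | forall i : 'I_n, I k (tnth x i)]).
  apply/seteqP; split => // x _.
  pose M := \sum_(i < n) `|tnth x i|.
  have [k Mk] : exists k : nat, M < k%:R.
    exists (Num.bound M); apply: archi_boundP; exact: sumr_ge0.
  exists k => // i; rewrite /I /= in_itv /= -ltr_norml (le_lt_trans _ Mk) //.
  by rewrite /M (bigD1 i) //= lerDl sumr_ge0.
move=> k; split; first exact: measurable_box (mI k).
rewrite (@lebesgue_tuple_box R n (fun=> I k)); last exact: mI.
have [r ->] : exists r : R, lebesgue_measure (I k) = r%:E.
  by rewrite lebesgue_measure_itv /=; case: ifP => _; eexists; rewrite -?EFinB.
by rewrite prodEFin ltry.
Qed.

Section LebesgueConsIntegral.
Variables (R : realType) (n : nat).
Local Notation rn k := (k.-tuple (measurableTypeR R)).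
Variable mu : {sigma_finite_measure set (rn n) -> \bar R}.
Local Notation leb := (@lebesgue_measure R).
Variables (H : rn n -> R) (h : measurableTypeR R -> R) (G : rn n.+1 -> R).
Hypothesis iH : mu.-integrable setT (EFin \o H).
Hypothesis ih : leb.-integrable setT (EFin \o h).
Hypothesis mG : measurable_fun setT G.
Hypothesis GE : forall x t, G (tcons (x, t)) = h t * H x.

Let mGt : measurable_fun setT (fun z : rn n * measurableTypeR R => (G (tcons z))%:E).
Proof.
by apply/measurable_EFinP; apply: measurableT_comp mG _; exact: measurable_tcons.
Qed.

Let mh : measurable_fun setT h.
Proof. by apply/measurable_EFinP; exact: measurable_int ih. Qed.

Let mH : measurable_fun setT H.
Proof. by apply/measurable_EFinP; exact: measurable_int iH. Qed.

(** Tonelli: the iterated integral of the absolute value splits into two finite factors. *)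
Let iGt : (mu \x leb)%E.-integrable setT
  (fun z : rn n * measurableTypeR R => (G (tcons z))%:E).
Proof.
apply/integrable12ltyP => //=.
have e x : (\int[leb]_t `|(G (tcons (x, t)))%:E| =
    `|H x|%:E * \int[leb]_t `|(h t)%:E|)%E.
  under eq_integral => t _ do rewrite GE mulrC EFinM abseM.
  rewrite ge0_integralZl //; exact/measurable_EFinP/measurableT_comp.
under eq_integral => x _ do rewrite e.
rewrite ge0_integralZr //; last 2 first.
- exact/measurable_EFinP/measurableT_comp.
- exact: integral_ge0.
rewrite lte_mul_pinfty ?integral_ge0 //.
- by case/integrableP: iH => _ /=; rewrite ge0_fin_numE // integral_ge0.
by case/integrableP: ih.
Qed.

Lemma integrable_lebesgue_cons :
  (lebesgue_cons mu).-integrable setT (EFin \o G).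
Proof.
apply: (integrable_pushforward (@measurable_tcons R n)) => //.
exact/measurable_EFinP.
Qed.

(** Pull back along [tcons], then apply Fubini; the inner integral over t is a constant multiple of
    H. *)
Lemma Rintegral_lebesgue_cons :
  \int[lebesgue_cons mu]_x G x = (\int[leb]_t h t) * (\int[mu]_x H x).
Proof.
rewrite /Rintegral.
have -> : (\int[lebesgue_cons mu]_x (G x)%:E =
    \int[mu \x leb]_z (fun z : rn n * measurableTypeR R => (G (tcons z))%:E) z)%E.
  rewrite -[LHS]/(\int[pushforward (mu \x leb) (@tcons R n)]_x (EFin \o G) x)%E.
  rewrite (integral_pushforward (@measurable_tcons R n)) //.
  exact/measurable_EFinP.
rewrite -integral12_prod_meas1 // /fubini_F /=.
have e x : (\int[leb]_t (G (tcons (x, t)))%:E =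
    (H x)%:E * \int[leb]_t (h t)%:E)%E.
  under eq_integral => t _ do rewrite GE mulrC EFinM.
  exact: integralZl.
under eq_integral => x _ do rewrite e.
have hE : (\int[leb]_t (h t)%:E \is a fin_num)%E by exact: integrable_fin_num.
have HE : (\int[mu]_t (H t)%:E \is a fin_num)%E by exact: integrable_fin_num.
by rewrite -(fineK hE) integralZr //= -(fineK HE) -EFinM mulrC.
Qed.

End LebesgueConsIntegral.

Section SigmaFiniteCopy.
Context (d : measure_display) (T : measurableType d) (R : realType).
Variable mu : {measure set T -> \bar R}.

(** A copy of mu whose phantom argument carries the sigma-finiteness proof, so that the structure
    can be inferred. *)
Definition sigma_finite_copy (_ : sigma_finite setT mu) : set T -> \bar R := mu.

HB.instance Definition _ sf := Measure.copy (sigma_finite_copy sf) mu.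
HB.instance Definition _ sf :=
  Measure_isSigmaFinite.Build _ _ _ (sigma_finite_copy sf) sf.
End SigmaFiniteCopy.

Lemma measurable_fun_prod_tnth (R : realType) (n : nat)
    (h : 'I_n -> measurableTypeR R -> R) :
  (forall i, measurable_fun setT (h i)) ->
  measurable_fun setT
    (fun x : n.-tuple (measurableTypeR R) => \prod_(i < n) h i (tnth x i)).
Proof.
move=> mh; apply: (measurable_prod (h := fun i x => h i (tnth x i))) => i _.
by apply: measurableT_comp => //; exact: measurable_tnth.
Qed.

(** Integrability and value go through one induction, since the Fubini step needs the tail to be
    integrable. *)
Lemma lebesgue_tuple_prod (R : realType) (n : nat)
    (h : 'I_n -> measurableTypeR R -> R) :
  (forall i, (@lebesgue_measure R).-integrable setT (EFin \o h i)) ->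
  (lebesgue_tuple R n).-integrable setT
    (EFin \o (fun x => \prod_(i < n) h i (tnth x i))) /\
  \int[lebesgue_tuple R n]_x (\prod_(i < n) h i (tnth x i)) =
    \prod_(i < n) \int[@lebesgue_measure R]_t h i t.
Proof.
have mh k (g : 'I_k -> measurableTypeR R -> R) :
    (forall i, (@lebesgue_measure R).-integrable setT (EFin \o g i)) ->
    forall i, measurable_fun setT (g i).
  by move=> ig i; apply/measurable_EFinP; exact: measurable_int (ig i).
elim: n => [|n IHn] in h *; move=> ih.
  have h1 (x : 0.-tuple (measurableTypeR R)) : \prod_(i < 0) h i (tnth x i) = 1.
    by rewrite big_ord0.
  rewrite (_ : (fun x => _) = cst 1); last exact/funext.
  have D1 : lebesgue_tuple R 0 setT = 1%E by rewrite /= diracT.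
  rewrite big_ord0; split.
    apply/integrableP; split; first exact/measurable_EFinP/measurable_cst.
    by rewrite /= normr1 integral_cst //= diracT mul1e ltry.
  by rewrite Rintegral_cst // D1 mulr1.
pose mu : {sigma_finite_measure set (n.-tuple (measurableTypeR R)) -> \bar R} :=
  sigma_finite_copy (@lebesgue_tuple_sigma_finite R n).
have [iH eH] := IHn (fun i => h (lift ord0 i)) (fun i => ih (lift ord0 i)).
have GE (x : n.-tuple (measurableTypeR R)) (t : measurableTypeR R) :
    \prod_(i < n.+1) h i (tnth (tcons (x, t)) i) =
    h ord0 t * \prod_(i < n) h (lift ord0 i) (tnth x i).
  by rewrite big_ord_recl; congr (_ * _); apply: eq_bigr => i _; rewrite tnthS.
have mG := measurable_fun_prod_tnth (mh _ _ ih).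
split; first exact: (@integrable_lebesgue_cons R n mu _ _ _ iH (ih ord0) mG GE).
rewrite [LHS](@Rintegral_lebesgue_cons R n mu _ _ _ iH (ih ord0) mG GE).
by rewrite big_ord_recl; congr (_ * _).
Qed.

(** The power is extended by zero outside the interval, to serve as a factor on the whole line. *)
Lemma integral_exprn (R : realType) (k : nat) (a b : R) : a < b ->
  (@lebesgue_measure R).-integrable setT
    (EFin \o ((fun t : R => t ^+ k) \_ `]a, b[)) /\
  \int[@lebesgue_measure R]_t ((fun t : R => t ^+ k) \_ `]a, b[) t =
    (b ^+ k.+1 - a ^+ k.+1) / k.+1%:R.
Proof.
move=> ab; have cexp n : continuous (fun t : R => t ^+ n).
  by move=> x; exact: exprn_continuous.
have icc n : (@lebesgue_measure R).-integrable `[a, b]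
    (EFin \o (fun t : R => t ^+ n)).
  apply: continuous_compact_integrable; first exact: segment_compact.
  exact: continuous_subspaceT (cexp n).
have ioo : (@lebesgue_measure R).-integrable `]a, b[
    (EFin \o (fun t : R => t ^+ k)).
  by apply: integrableS (icc k) => //; exact: subset_itv_oo_cc.
have ico : (@lebesgue_measure R).-integrable `]a, b]
    (EFin \o (fun t : R => t ^+ k)).
  by apply: integrableS (icc k) => //; exact: subset_itv_oc_cc.
split.
  rewrite -restrict_EFin; apply: (iffLR (integrable_mkcond _ _)) ioo.
  exact: measurable_itv.
rewrite -Rintegral_mkcond Rintegral_itv_bndo_bndc // Rintegral_itv_obnd_cbnd //.
(* With the denominator cleared, t^(k+1) itself is the primitive. *)
apply: (@mulIf _ k.+1%:R); first by rewrite pnatr_eq0.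
rewrite mulfVK ?pnatr_eq0 // -RintegralZr //=.
rewrite /Rintegral (@continuous_FTC2 _ _ (fun t => t ^+ k.+1)) //.
- apply: continuous_subspaceT => x; apply: cvgM; [exact: cexp|exact: cvg_cst].
- split.
  + by move=> x _; exact: exprn_derivable.
  + exact: cvg_at_right_filter (cexp _ _).
  + exact: cvg_at_left_filter (cexp _ _).
- by move=> x _; rewrite exp_derive1 /= mulrC.
Qed.

(** * Integration over interlacing points *)

Lemma measurable_interlacing (R : realType) (m : nat) (y : m.+1.-tuple R) :
  measurable (interlacing y : set (m.-tuple (measurableTypeR R))).
Proof.
pose I (i : 'I_m) : set R :=
  [set` `]tnth y (widen_ord (leqnSn m) i), tnth y (lift ord0 i)[%R].
have -> : interlacing y = [set x : m.-tuple R | forall i, I i (tnth x i)].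
  by apply/seteqP; split => x /= xI i; have := xI i; rewrite /I /= in_itv.
by apply: (@measurable_box _ (measurableTypeR R) m I) => i; exact: measurable_itv.
Qed.

(** Interlacing constrains each x_i separately, so the domain is a box and the integral factors into
    one-dimensional ones. *)
Lemma integral_interlacing_exprn (R : realType) (m : nat) (y : m.+1.-tuple R)
    (k : 'I_m -> nat) :
  (forall i j : 'I_m.+1, (i < j)%N -> tnth y i < tnth y j) ->
  (lebesgue_tuple R m).-integrable (interlacing y)
    (EFin \o (fun x => \prod_(i < m) tnth x i ^+ k i)) /\
  \int[lebesgue_tuple R m]_(x in interlacing y) (\prod_(i < m) tnth x i ^+ k i) =
    \prod_(i < m) ((tnth y (lift ord0 i) ^+ (k i).+1 -
      tnth y (widen_ord (leqnSn m) i) ^+ (k i).+1) / (k i).+1%:R).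
Proof.
move=> yinc.
have ylt i : tnth y (widen_ord (leqnSn m) i) < tnth y (lift ord0 i).
  by apply: yinc; rewrite /= /bump.
pose I i : set R := [set` `]tnth y (widen_ord (leqnSn m) i), tnth y (lift ord0 i)[%R].
pose h i : measurableTypeR R -> R := (fun t : R => t ^+ k i) \_ (I i).
have interE : interlacing y = [set x : m.-tuple R | forall i, I i (tnth x i)].
  by apply/seteqP; split => x /= xI i; have := xI i; rewrite /I /= in_itv.
have mD := measurable_interlacing y.
have [ih eh] : (lebesgue_tuple R m).-integrable setT
    (EFin \o (fun x => \prod_(i < m) h i (tnth x i))) /\
    \int[lebesgue_tuple R m]_x (\prod_(i < m) h i (tnth x i)) =
    \prod_(i < m) \int[@lebesgue_measure R]_t h i t.
  by apply: lebesgue_tuple_prod => i; exact: (integral_exprn (k i) (ylt i)).1.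
have hE : (fun x => \prod_(i < m) tnth x i ^+ k i) \_ (interlacing y) =
    (fun x => \prod_(i < m) h i (tnth x i)).
  apply/funext => x; rewrite patchE; case: ifPn => [/set_mem|/negP xD].
    rewrite interE => xI; apply: eq_bigr => i _; rewrite /h patchE mem_set //; exact: xI.
  have [i xi] : exists i, ~ I i (tnth x i).
    by apply/existsNP => xI; apply: xD; rewrite inE interE.
  by rewrite (bigD1 i) //= /h patchE memNset // mul0r.
split.
  by apply: (iffRL (integrable_mkcond _ mD)); rewrite restrict_EFin hE.
rewrite Rintegral_mkcond hE eh; apply: eq_bigr => i _.
exact: (integral_exprn (k i) (ylt i)).2.
Qed.

Lemma Rintegral_lincomb d (T : measurableType d) (R : realType)
    (mu : {measure set T -> \bar R}) (D : set T) (I : Type) (r : seq I)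
    (c : I -> R) (g : I -> T -> R) :
  measurable D -> (forall i, mu.-integrable D (EFin \o g i)) ->
  mu.-integrable D (EFin \o (fun x => \sum_(i <- r) c i * g i x)) /\
  \int[mu]_(x in D) (\sum_(i <- r) c i * g i x) =
    \sum_(i <- r) c i * \int[mu]_(x in D) g i x.
Proof.
move=> mD ig.
have icg i : mu.-integrable D (EFin \o (fun x => c i * g i x)).
  by have := integrableZl mD (c i) (ig i); apply: eq_integrable => // x _ /=; rewrite EFinM.
elim: r => [|i r [IHi IHe]].
  rewrite big_nil (_ : (fun x => _) = cst 0); last first.
    by apply/funext => x; rewrite big_nil.
  by split; [exact: integrable0|by rewrite Rintegral_cst // mul0r].
rewrite big_cons (_ : (fun x => \sum_(j <- i :: r) _) =
    (fun x => c i * g i x + \sum_(j <- r) c j * g j x)); last first.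
  by apply/funext => x; rewrite big_cons.
split; first by have := integrableD mD (icg i) IHi;
  apply: eq_integrable => // x _ /=; rewrite EFinD.
by rewrite RintegralD // IHe RintegralZl.
Qed.

(** The functions g are real, so taking real and imaginary parts affects the coefficients only. *)
Lemma Cintegral_lincomb d (T : measurableType d) (R : realType)
    (mu : {measure set T -> \bar R}) (D : set T) (I : Type) (r : seq I)
    (c : I -> R[i]) (g : I -> T -> R) :
  measurable D -> (forall i, mu.-integrable D (EFin \o g i)) ->
  Cintegral mu D (fun x => \sum_(i <- r) c i * ((g i x)%:C)%C) =
    \sum_(i <- r) c i * ((\int[mu]_(x in D) g i x)%:C)%C.
Proof.
move=> mD ig.
have ReE (h : I -> R) : complex.Re (\sum_(i <- r) c i * ((h i)%:C)%C) =
    \sum_(i <- r) complex.Re (c i) * h i.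
  rewrite raddf_sum; apply: eq_bigr => i _ /=.
  by case: (c i) => a b; rewrite /= mulr0 subr0.
have ImE (h : I -> R) : complex.Im (\sum_(i <- r) c i * ((h i)%:C)%C) =
    \sum_(i <- r) complex.Im (c i) * h i.
  rewrite raddf_sum; apply: eq_bigr => i _ /=.
  by case: (c i) => a b; rewrite /= mulr0 add0r.
apply/eqP; rewrite eq_complex ReE ImE /=; apply/andP; split; apply/eqP.
  by under eq_Rintegral => x _ do rewrite ReE; rewrite (Rintegral_lincomb r _ mD ig).2.
by under eq_Rintegral => x _ do rewrite ImE; rewrite (Rintegral_lincomb r _ mD ig).2.
Qed.

(** Row i involves only x_i, so each Leibniz term is a product of one-variable powers, and the
    integral passes into the entries. *)
Lemma integral_interlacing_alternant (R : realType) (m : nat)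
    (y : m.+1.-tuple R) (l : 'I_m -> nat) :
  (forall i j : 'I_m.+1, (i < j)%N -> tnth y i < tnth y j) ->
  let g (x : m.-tuple (measurableTypeR R)) :=
    \det (\matrix_(i < m, j < m) tnth x i ^+ l j) in
  (lebesgue_tuple R m).-integrable (interlacing y) (EFin \o g) /\
  \int[lebesgue_tuple R m]_(x in interlacing y) g x =
    \det (\matrix_(i < m, j < m)
      ((tnth y (lift ord0 i) ^+ (l j).+1 -
        tnth y (widen_ord (leqnSn m) i) ^+ (l j).+1) / (l j).+1%:R)).
Proof.
move=> yinc g.
pose h (s : 'S_m) (x : m.-tuple (measurableTypeR R)) :=
  \prod_(i < m) tnth x i ^+ l (s i).
have gE : g = fun x => \sum_(s : 'S_m) (-1) ^+ s * h s x.
  apply/funext => x; apply: eq_bigr => s _; congr (_ * _).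
  by apply: eq_bigr => i _; rewrite mxE.
have hP s := integral_interlacing_exprn (fun i => l (s i)) yinc.
have [ih eh] := Rintegral_lincomb (index_enum 'S_m) (fun s => (-1) ^+ s)
  (measurable_interlacing y) (fun s => (hP s).1).
rewrite gE; split=> //; rewrite [LHS]eh; apply: eq_bigr => s _.
congr (_ * _); rewrite (hP s).2; apply: eq_bigr => i _.
by rewrite mxE.
Qed.

(** * Evaluation of the determinant and the integral formula on Schur functions *)

Lemma det_row_differences (A : comNzRingType) (m : nat) (M : 'M[A]_m.+1) :
  (forall i, M i ord_max = 1) ->
  \det M = (-1) ^+ m * \det (\matrix_(i < m, j < m)
    (M (lift ord0 i) (widen_ord (leqnSn m) j) -
     M (widen_ord (leqnSn m) i) (widen_ord (leqnSn m) j))).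
Proof.
move=> M1.
(* Unitriangular matrix subtracting from each row its predecessor. It turns the last column into (1,
   0, ..., 0), and expansion along that column gives the sign (-1)^m. *)
pose L : 'M[A]_m.+1 := \matrix_(i, k) ((i == k)%:R - ((i : nat) == k.+1)%:R).
have L1 : \det L = 1.
  rewrite det_trig; last first.
    apply/is_trig_mxP => i k ik; rewrite mxE.
    have /negPf -> : i != k by apply: contraTneq ik => ->; rewrite ltnn.
    have /negPf -> : (i : nat) != k.+1 by rewrite neq_ltn ltnW.
    by rewrite subrr.
  by rewrite big1 // => i _; rewrite mxE eqxx (ltn_eqF (ltnSn i)) subr0.
have LM0 j : (L *m M) ord0 j = M ord0 j.
  rewrite mxE (bigD1 ord0) //= big1 => [|k k0]; rewrite mxE.
    by rewrite eqxx subr0 mul1r addr0.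
  by rewrite eq_sym (negPf k0) subrr mul0r.
have LMS i j : (L *m M) (lift ord0 i) j =
    M (lift ord0 i) j - M (widen_ord (leqnSn m) i) j.
  rewrite mxE (bigD1 (lift ord0 i)) //= (bigD1 (widen_ord (leqnSn m) i)) /=; last first.
    by rewrite -val_eqE /= neq_ltn ltnSn.
  rewrite big1 => [|k /andP[k1 k2]]; rewrite !mxE.
    rewrite -!val_eqE /= /bump /= !add1n !eqxx (ltn_eqF (ltnSn i.+1)).
    by rewrite (gtn_eqF (ltnSn i)) subr0 sub0r mul1r mulN1r addr0.
  rewrite eq_sym (negPf k1) sub0r /= /bump /= add1n eqSS.
  by rewrite -val_eqE /= in k2; rewrite eq_sym (negPf k2) oppr0 mul0r.
have -> : \det M = \det (L *m M) by rewrite det_mulmx L1 mul1r.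
rewrite (expand_det_col _ ord_max).
rewrite (bigD1 ord0) //= big1 ?addr0 => [|i i0]; last first.
  have [k ->|/eqP] := unliftP ord0 i; last by rewrite (negPf i0).
  by rewrite LMS !M1 subrr mul0r.
rewrite LM0 M1 mul1r /cofactor add0n; congr (_ * \det _).
apply/matrixP => i j; rewrite [RHS]mxE [LHS]mxE [LHS]mxE LMS.
suff -> : lift ord_max j = widen_ord (leqnSn m) j by [].
by apply: val_inj; rewrite /= /bump leqNgt ltn_ord.
Qed.

(** Keeping Delta on the left makes this valid also where coordinates coincide; the right side is a
    real number, ready to be integrated. *)
Lemma eval_real_schur (R : realType) (N : nat) (lam : N.-tuple nat)
    (x : N.-tuple R) :
  eval_real (schur R[i] lam) x * ((vandermonde (tnth x))%:C)%C =
  ((\det (\matrix_(i < N, j < N) tnth x i ^+ shifted lam j))%:C)%C.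
Proof.
pose v i : R[i] := ((tnth x i)%:C)%C.
have := congr1 (meval v) (schurE R[i] lam).
rewrite mevalM /alternant -!det_map_mx => e.
transitivity (\det (map_mx (meval v)
    (\matrix_(i < N, j < N) 'X_i ^+ (tnth lam j + (N - j.+1))))).
  rewrite -e /eval_real; congr (_ * _); rewrite /vandermonde !rmorph_prod.
  apply: eq_bigr => i _; rewrite !rmorph_prod; apply: eq_bigr => j _.
  by rewrite !rmorphB /= !mevalXU.
congr (\det _); apply/matrixP => i j; rewrite !mxE !rmorphXn /= mevalXU.
by rewrite mnmE.
Qed.

Lemma eval_real_lincomb (R : realType) (N : nat) (y : N.-tuple R) (I : Type)
    (r : seq I) (c : I -> R[i]) (f : I -> sympoly N R[i]) :
  eval_real (\sum_(i <- r) c i *: f i) y =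
  \sum_(i <- r) c i * eval_real (f i) y.
Proof.
elim: r => [|i r IH]; first by rewrite !big_nil /eval_real meval0.
by rewrite !big_cons -IH /eval_real /= mevalD mevalZ.
Qed.

(** The integral formula for f = s_lambda; the factor s_lambda(1) is there because Q_0' is known on
    the normalised Schur functions. *)
Lemma schur_rcons_interlacing (R : realType) (m : nat) (lam : m.-tuple nat)
    (y : m.+1.-tuple R) : is_partition lam ->
  (forall i j : 'I_m.+1, (i < j)%N -> tnth y i < tnth y j) ->
  (schur R[i] lam : {mpoly R[i][m]}).@[fun=> 1] *
    eval_real (schur_bar R[i] [tuple of rcons lam 0%N]) y =
  (((-1) ^+ m * (m`!%:R / vandermonde (tnth y)))%:C)%C *
  ((\int[lebesgue_tuple R m]_(x in interlacing y)
     \det (\matrix_(i < m, j < m) tnth x i ^+ shifted lam j))%:C)%C.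
Proof.
move=> plam yinc; rewrite (integral_interlacing_alternant (shifted lam) yinc).2.
have V0 : vandermonde (tnth y) != 0.
  apply: vandermonde_neq0_inj => i j e; apply/val_inj; case: (ltngtP i j) => //= ij.
    by have := yinc _ _ ij; rewrite e ltxx.
  by have := yinc _ _ ij; rewrite e ltxx.
pose P : R := \prod_(j < m) (shifted lam j).+1%:R.
have P0 : P != 0 by apply/prodf_neq0 => j _; rewrite pnatr_eq0.
set rc := [tuple of rcons lam 0%N].
pose D := \det (\matrix_(i < m, j < m)
  (tnth y (lift ord0 i) ^+ (shifted lam j).+1 -
   tnth y (widen_ord (leqnSn m) i) ^+ (shifted lam j).+1)).
have detE : \det (\matrix_(i < m.+1, j < m.+1) tnth y i ^+ shifted rc j) =
    (-1) ^+ m * D.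
  have rcM : shifted rc ord_max = 0%N.
    by rewrite !mnmE !(tnth_nth 0%N) /= nth_rcons size_tuple ltnn eqxx subnn.
  rewrite det_row_differences => [|i]; last by rewrite mxE rcM.
  congr (_ * \det _); apply/matrixP => i j; rewrite !mxE.
  have -> // : shifted rc (widen_ord (leqnSn m) j) = (shifted lam j).+1.
  by rewrite !mnmE !(tnth_nth 0%N) /= nth_rcons size_tuple ltn_ord -addnS subSS subnSK.
(* Column j carries the common factor 1 / (l_j + 1). *)
have -> : \det (\matrix_(i < m, j < m)
    ((tnth y (lift ord0 i) ^+ (shifted lam j).+1 -
      tnth y (widen_ord (leqnSn m) i) ^+ (shifted lam j).+1) /
      (shifted lam j).+1%:R)) = D / P.
  rewrite /D /P -prodfV.
  rewrite (_ : \prod_(j < m) _ = \det (diag_mx (\row_j (shifted lam j).+1%:R^-1 : 'rV[R]_m))).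
    rewrite -det_mulmx; congr (\det _); apply/matrixP => i j.
    by rewrite mul_mx_diag !mxE.
  by rewrite det_diag; apply: eq_bigr => j _; rewrite mxE.
have := schur_rcons_1 R[i] lam; rewrite -/rc.
have b0 : (schur R[i] rc : {mpoly R[i][m.+1]}).@[fun=> 1] != 0.
  by rewrite schur_1_neq0 ?is_partition_rcons0.
have PE : \prod_(j < m) (shifted lam j).+1%:R = (P%:C)%C :> R[i].
  by rewrite /P rmorph_prod; apply: eq_bigr => j _; rewrite rmorph_nat.
have mE : m`!%:R = ((m`!%:R : R)%:C)%C by rewrite rmorph_nat.
have CV0 : ((vandermonde (tnth y))%:C)%C != 0 :> R[i] by rewrite (fmorph_eq0 (real_complex R)).
have CP0 : (P%:C)%C != 0 :> R[i] by rewrite (fmorph_eq0 (real_complex R)).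
rewrite PE mE => ab.
have eE : eval_real (schur_bar R[i] rc) y =
    (schur R[i] rc : {mpoly R[i][m.+1]}).@[fun=> 1]^-1 * eval_real (schur R[i] rc) y.
  by rewrite /eval_real /schur_bar /= mevalZ.
apply: (mulIf CV0); rewrite eE -!mulrA eval_real_schur detE.
(* The ratio of dimensions from [schur_rcons_1]; its m! is the constant of the formula, and its 1 /
   P matches the integrated columns. *)
have aE : (schur R[i] lam : {mpoly R[i][m]}).@[fun=> 1] *
    (schur R[i] rc : {mpoly R[i][m.+1]}).@[fun=> 1]^-1 =
    ((m`!%:R / P)%:C)%C.
  rewrite [RHS](fmorph_div (real_complex R)); apply/eqP.
  by rewrite eqr_div // -ab mulrC.
rewrite mulrA aE -!rmorphM /=; congr (real_complex R _).
by field; rewrite P0 V0.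
Qed.

Theorem proposition4p3 (R : realType) (m : nat) (hn : (2 <= m.+1)%N)
    (Q : R[i] -> {linear sympoly m.+1 R[i] -> sympoly m.+1 R[i]})
    (hQ : forall (z : R[i]) (lam : m.+1.-tuple nat), is_partition lam ->
       Q z (schur_bar R[i] lam) = schur_bar_z1 lam z *: schur_bar R[i] lam) :
  exists Q0' : {linear sympoly m R[i] -> sympoly m.+1 R[i]},
    [/\ forall f : sympoly m.+1 R[i], Q 0 f = Q0' (eval_last0 f),
        forall L : {linear sympoly m R[i] -> sympoly m.+1 R[i]},
          (forall f : sympoly m.+1 R[i], Q 0 f = L (eval_last0 f)) -> L =1 Q0',
        forall lam : m.-tuple nat, is_partition lam ->
          Q0' (schur_bar R[i] lam) = schur_bar R[i] [tuple of rcons lam 0%N]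
      & forall (y : m.+1.-tuple R) (f : sympoly m R[i]),
          0 < tnth y ord0 ->
          (forall i j : 'I_m.+1, (i < j)%N -> tnth y i < tnth y j) ->
          eval_real (Q0' f) y =
            (((-1) ^+ m * (m`!%:R / vandermonde (tnth y)))%:C)%C *
            Cintegral (lebesgue_tuple R m) (interlacing y)
              (fun x => ((vandermonde (tnth x))%:C)%C * eval_real f x)].
Proof.
have [Q0' QE] := linear_factor (@eval_last0_surj R[i] m) (eval_last0_ker (hQ 0)).
have Q0'bar := factor_schur_bar (hQ 0) QE.
exists Q0'; split => // [L LE g|y f y0 yinc].
  (* Uniqueness: P is surjective. *)
  by have [f <-] := eval_last0_surj g; rewrite -LE QE.
have [r /allP rP fE] := schur_expansion f.
pose g (lam : m.-tuple nat) (x : m.-tuple (measurableTypeR R)) :=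
  \det (\matrix_(i < m, j < m) tnth x i ^+ shifted lam j).
(* Delta * f is a combination of real alternants with complex coefficients, so both sides can be
   compared one partition at a time. *)
have -> : (fun x : m.-tuple R => ((vandermonde (tnth x))%:C)%C * eval_real f x) =
    (fun x => \sum_(lam <- r) schur_coef lam f * ((g lam x)%:C)%C).
  apply/funext => x; rewrite [in LHS]fE eval_real_lincomb mulr_sumr.
  by apply: eq_bigr => lam _; rewrite -eval_real_schur mulrCA [eval_real _ _ * _]mulrC.
rewrite Cintegral_lincomb; last 2 first.
- exact: measurable_interlacing.
- by move=> lam; exact: (integral_interlacing_alternant (shifted lam) yinc).1.
rewrite [in LHS]fE linear_sum mulr_sumr /=.
rewrite (eq_bigr (fun lam => schur_coef lam f *: Q0' (schur R[i] lam))); last first.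
  by move=> lam _; rewrite linearZ.
rewrite eval_real_lincomb !big_seq; apply: eq_bigr => lam /rP plam.
rewrite mulrCA -schur_rcons_interlacing // -Q0'bar //; congr (_ * _).
(* The factor s_lambda(1) cancels the normalisation of [schur_bar]. *)
rewrite /schur_bar linearZ /= /eval_real /= mevalZ mulrA divff ?mul1r //.
exact: schur_1_neq0.
Qed.
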